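(* Let $A$ be a finite subset of a group $G_0$ and let $G=\langle A^{-1}A\rangle$ be the subgroup of $G_0$ generated by $A^{-1}A$. If $|A^{-1}A|<\min\left(|G|,\frac{5|A|}{3}\right)$, then there are a normal subgroup $K$ of $G$ and a subgroup $H$ of $G$ with $K\subset H\subset A^{-1}A$ and $2|K|\ge |H|$ such that $$A^{-1}AK=KA^{-1}A=A^{-1}A\quad\text{and}\quad 6|K|\ge |A^{-1}A|=3|H|.$$
   Context: For subsets $X,Y$ of a group, $XY=\{xy : x\in X,\ y\in Y\}$ is the Minkowski product and $X^{-1}=\{x^{-1}: x\in X\}$. *)

(* Defs.v *)
From HB Require Import structures.
From mathcomp Require Import all_boot all_order all_algebra finmap.
From mathcomp Require Import boolp classical_sets functions cardinality.
From mathcomp Require Import constructive_ereal.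

Set Implicit Arguments.
Unset Strict Implicit.
Unset Printing Implicit Defensive.

Local Open Scope group_scope.
Local Open Scope classical_set_scope.

Definition mulset (T : groupType) (X Y : set T) : set T :=
  [set x * y | x in X & y in Y].

Definition invset (T : groupType) (X : set T) : set T := [set x^-1 | x in X].

Definition is_subgroup (T : groupType) (H : set T) : Prop :=
  group_closed [in H].

Definition generated (T : groupType) (X : set T) : set T :=
  smallest (@is_subgroup T) X.

Definition subgroup_of (T : groupType) (H G : set T) : Prop :=
  is_subgroup H /\ H `<=` G.

Definition normal_subgroup_of (T : groupType) (K G : set T) : Prop :=
  subgroup_of K G /\ forall x y, G x -> K y -> K (y ^ x).

(* Cardinality with value +oo on every infinite set: the generated subgroup may
   be infinite, whereas #|` fset_set X | is 0 when X is infinite. *)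
Definition ecard (T : choiceType) (X : set T) : \bar rat :=
  if `[< finite_set X >] then (#|` fset_set X |%fset%:R)%R%:E else +oo%E.

(* Main.v *)
Require Import Defs.
From HB Require Import structures.
From mathcomp Require Import all_boot all_order all_algebra finmap.
From mathcomp Require Import boolp classical_sets functions cardinality.
From mathcomp Require Import constructive_ereal.
From mathcomp Require Import zify.

Set Implicit Arguments.
Unset Strict Implicit.
Unset Printing Implicit Defensive.

(* Translate so that 1 is in A, and put D = A^-1 A. Among the sets X of G with
   XB <> G, where B is A or A^-1, one minimising |XB| - |X| and then |X| can be
   translated to a subgroup H, and |HB| - |H| <= |D| - |A| < 2|A|/3. Hence HB
   is the union of two cosets H and Hx, and 3|H| < 2|A|.
   If B = A, pigeonhole shows that D is the union of H, Hx, x^-1 H and H^x.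
   Since |D| < 10|H|/3, the intersection L of H and H^x has index 1 or 2 in H.
   If the index is 1, then H is normal and D consists of H, Hx and Hx^-1; if it
   is 2, then Hx contains some y with y^2 in H, and L is normal in G.
   If B = A^-1, then A is the union of some A1 and x A2 with A1, A2 in H. Let
   P = A1^-1 x A2. From |P| |L| >= |A1| |A2| the index of L in H is at most 2,
   and then pigeonhole gives P = HxH, so D is the union of H, HxH and
   (HxH)^-1 and one concludes in the same way. *)

(* [#|` X|] is elaborated with either the group or the choice carrier; [simpl]
   makes these forms agree, without which [lia] sees distinct atoms. *)
Ltac slia := simpl in *; lia.

(** * Products of finite sets and the isoperimetric method *)

Section FiniteProducts.
Local Open Scope fset_scope.
Local Open Scope group_scope.
Variable T : groupType.
Implicit Types (A B X Y H K : {fset T}) (S G : {pred T}) (x y z : T).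

Definition fmul X Y : {fset T} := [fset x * y | x in X, y in Y].
Definition finvset X : {fset T} := [fset x^-1 | x in X].
Definition flcoset x X : {fset T} := [fset x * y | y in X].
Definition frcoset X x : {fset T} := [fset y * x | y in X].

Lemma fmulP X Y z :
  reflect (exists x y, [/\ x \in X, y \in Y & z = x * y]) (z \in fmul X Y).
Proof.
apply: (iffP (imfset2P _ _ _ _ _)) => [[x xX [y yY ->]]|[x [y [xX yY ->]]]].
  by exists x, y.
by exists x => //; exists y.
Qed.

Lemma mem_fmul X Y x y : x \in X -> y \in Y -> x * y \in fmul X Y.
Proof. by move=> xX yY; apply/fmulP; exists x, y. Qed.

Lemma mem_finvset X x : (x \in finvset X) = (x^-1 \in X).
Proof. by rewrite -[in LHS](invgK x) (mem_imfset _ _ invg_inj). Qed.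

Lemma mem_flcoset x X z : (z \in flcoset x X) = (x^-1 * z \in X).
Proof. by rewrite -[in LHS](mulVKg x z) (mem_imfset _ _ (mulgI x)). Qed.

Lemma mem_frcoset x X z : (z \in frcoset X x) = (z / x \in X).
Proof. by rewrite -[in LHS](mulgVK x z) (mem_imfset _ _ (mulIg x)). Qed.

Lemma card_finvset X : #|` finvset X| = #|` X|.
Proof. exact: card_imfset invg_inj. Qed.

Lemma card_flcoset x X : #|` flcoset x X| = #|` X|.
Proof. exact: card_imfset (mulgI x). Qed.

Lemma card_frcoset x X : #|` frcoset X x| = #|` X|.
Proof. exact: card_imfset (mulIg x). Qed.

Lemma finvsetK : involutive finvset.
Proof. by move=> X; apply/fsetP => x; rewrite !mem_finvset invgK. Qed.

Lemma fmul_flcoset x X Y : fmul (flcoset x X) Y = flcoset x (fmul X Y).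
Proof.
apply/fsetP => z; rewrite mem_flcoset; apply/fmulP/fmulP.
  move=> [u [v [uX vY ->]]]; exists (x^-1 * u), v.
  by rewrite -mem_flcoset mulgA.
move=> [u [v [uX vY e]]]; exists (x * u), v.
by rewrite mem_flcoset mulKg -mulgA -e mulVKg.
Qed.

Lemma fmulUl X Y Z : fmul (X `|` Y) Z = fmul X Z `|` fmul Y Z.
Proof.
apply/fsetP => z; rewrite inE; apply/fmulP/orP.
  by move=> [x [y [/[!inE]/orP[xX|xY] yZ ->]]]; [left|right]; apply: mem_fmul.
by move=> [|] /fmulP[x [y [xX yZ ->]]]; exists x, y; rewrite inE xX ?orbT.
Qed.

Lemma fmulS X X' Y : X `<=` X' -> fmul X Y `<=` fmul X' Y.
Proof.
move=> /fsubsetP sX; apply/fsubsetP => z /fmulP[x [y [xX yY ->]]].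
by apply: mem_fmul => //; apply: sX.
Qed.

Lemma leq_card_fmul X Y : Y != fset0 -> (#|` X| <= #|` fmul X Y|)%N.
Proof.
move=> /fset0Pn[y yY]; rewrite -(card_frcoset y).
apply/fsubset_leq_card/fsubsetP => z; rewrite mem_frcoset => zX.
by rewrite -(mulgVK y z); apply: mem_fmul.
Qed.

Lemma group_closedMl S x y :
  group_closed S -> x \in S -> (x * y \in S) = (y \in S).
Proof.
move=> gS xS; apply/idP/idP; last exact: (group_closedM gS).
by move=> xyS; rewrite -(mulKg x y) (group_closedM gS) ?(group_closedV gS).
Qed.

Lemma group_closedMr S x y :
  group_closed S -> x \in S -> (y * x \in S) = (y \in S).
Proof.
move=> gS xS; apply/idP/idP; last by move=> yS; apply: (group_closedM gS).
by move=> yxS; rewrite -(mulgK x y); case: gS => _; apply.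
Qed.

Lemma group_closedVE S x : group_closed S -> (x^-1 \in S) = (x \in S).
Proof.
move=> gS; apply/idP/idP; last exact: (group_closedV gS).
by move/(group_closedV gS); rewrite invgK.
Qed.

Lemma exists_minimal (U : Type) (P : U -> Prop) (m : U -> nat) :
  (exists u, P u) -> exists2 u, P u & forall v, P v -> (m u <= m v)%N.
Proof.
move=> [u0 Pu0]; pose p n := `[< exists2 u, P u & m u = n >].
have p0 : exists n, p n by exists (m u0); apply/asboolP; exists u0.
case: (ex_minnP p0) => n /asboolP[u Pu <-] mn; exists u => // v Pv.
by apply: mn; apply/asboolP; exists v.
Qed.

(** [G] may be infinite, so [XB <> G] is recorded by a point of [G] that the product misses. *)
Definition separated G B X :=
  [/\ X != fset0, {subset X <= G} & exists2 z, z \in G & z \notin fmul X B].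

(* Hamidoune's isoperimetric method. If two atoms [X] and [Y] meet while
   [XB `|` YB] is all of [G], then the complement of [XB] is a fragment for
   [B^-1] of size smaller than [X]; minimising over [A] and [A^-1] together
   rules this out. *)
Lemma atom_subgroup G A : group_closed G -> {subset A <= G} -> A != fset0 ->
    (exists X, separated G A X) ->
  exists B H, [/\ B = A \/ B = finvset A, group_closed [in H], separated G B H &
    forall X, separated G A X ->
      (#|` fmul H B| + #|` X| <= #|` fmul X A| + #|` H|)%N].
Proof.
move=> gG sAG A0 [X0 X0P].
pose P (p : {fset T} * {fset T}) :=
  (p.1 = A \/ p.1 = finvset A) /\ separated G p.1 p.2.
(* The truncated difference is exact: [B] is nonempty, so [XB] is at least as large as [X]. *)
pose e (p : {fset T} * {fset T}) := (#|` fmul p.2 p.1| - #|` p.2|)%N.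
have PB p : P p -> {subset p.1 <= G} /\ p.1 != fset0.
  move=> [[->|->] _]; split => //.
    by move=> x; rewrite mem_finvset => /sAG; rewrite group_closedVE.
  by rewrite -cardfs_gt0 card_finvset cardfs_gt0.
have eP p : P p -> (#|` fmul p.2 p.1| = e p + #|` p.2|)%N.
  by move=> /PB[_ p0]; rewrite subnK // leq_card_fmul.
have [p1 Pp1 min1] : exists2 p, P p & forall q, P q -> (e p <= e q)%N.
  by apply: exists_minimal; exists (A, X0); split => //=; left.
have [[B X] [PX eX] min2] : exists2 p, P p /\ e p = e p1 &
    forall q, P q /\ e q = e p1 -> (#|` p.2| <= #|` q.2|)%N.
  by apply: (@exists_minimal _ (fun q => P q /\ e q = e p1)); exists p1.
rewrite -{p1 Pp1}eX in min1 min2.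
have [sBG B0] := PB _ PX; have eXX := eP _ PX; rewrite /= in sBG B0 eXX.
have [/= eqB [X0' sXG [z zG zX]]] := PX.
have sXBG : {subset fmul X B <= G}.
  move=> _ /fmulP[u [v [/sXG uG /sBG vG ->]]]; exact: (group_closedM gG).
have meet Y : P (B, Y) -> e (B, Y) = e (B, X) -> #|` Y| = #|` X| ->
    X `&` Y != fset0 -> Y = X.
  move=> PY eY cY IXY; have /= eYY := eP _ PY.
  have [_ /= [_ sYG [z' z'G z'Y]]] := PY.
  have PI : P (B, X `&` Y).
    split=> //=; split=> //; first by move=> x /[!inE]/andP[/sXG].
    exists z => //; apply: contra zX; apply/fsubsetP/fmulS/fsubsetIl.
  have /= eI := eP _ PI; have leI := min1 _ PI.
  have sI : fmul (X `&` Y) B `<=` fmul X B `&` fmul Y B.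
    by rewrite fsubsetI !fmulS ?fsubsetIl ?fsubsetIr.
  have cI := fsubset_leq_card sI.
  have cUI := cardfsUI (fmul X B) (fmul Y B).
  have cUI' := cardfsUI X Y.
  (* If the union is still separated, submodularity bounds the sum of [e] over intersection and
     union by twice the minimum. So the intersection attains the minimum, and the choice of [X]
     makes it all of [X]. *)
  have [w|nw] := pselect (exists2 z, z \in G & z \notin fmul (X `|` Y) B).
    have PU : P (B, X `|` Y).
      split=> //=; split=> //; last by move=> x /[!inE]/orP[/sXG|/sYG].
      by apply: contra X0'; rewrite -!fsubset0; apply: fsubset_trans (fsubsetUl _ _).
    have /= eU := eP _ PU; have leU := min1 _ PU; rewrite fmulUl in eU.
    have eqI : e (B, X `&` Y) = e (B, X) by slia.
    have /= cX := min2 _ (conj PI eqI).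
    have /fsetIidPl XY : X `&` Y = X.
      by apply/eqP; rewrite eqEfcard fsubsetIl.
    by apply/esym/eqP; rewrite eqEfcard XY /= cY.
  (* Otherwise [W] is [G], which is then finite. The complement [X'] of [XB] has [X' B^-1] disjoint
     from [X], so its [e] is also minimal, while [|X'| <= |X| - |X & Y|] contradicts the choice of
     [X]. *)
  pose W := fmul X B `|` fmul Y B.
  have WG x : (x \in W) = (x \in G).
    apply/idP/idP.
      rewrite inE => /orP[/sXBG//|/fmulP[u [v [/sYG uG /sBG vG ->]]]].
      exact: (group_closedM gG).
    by move=> xG; apply/negPn/negP => xW; apply: nw; exists x; rewrite // fmulUl.
  pose X' := W `\` fmul X B.
  have sX' : fmul X' (finvset B) `<=` W `\` X.
    apply/fsubsetP => _ /fmulP[u [v [uX' vB ->]]].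
    move: uX'; rewrite mem_finvset in vB; rewrite !in_fsetD => /andP[uXB uW].
    apply/andP; split.
      by apply: contra uXB => uvX; rewrite -(mulgK v u) mem_fmul.
    by rewrite WG (group_closedM gG) -?WG // WG -group_closedVE // sBG.
  have sXW : X `<=` W by apply/fsubsetP => x /sXG; rewrite WG.
  have sXBW : fmul X B `<=` W by apply: fsubsetUl.
  have PX' : P (finvset B, X').
    split=> /=; first by case: eqB => ->; rewrite ?finvsetK; [right|left].
    split.
    - by apply/fset0Pn; exists z; rewrite /X' inE zX WG.
    - by move=> x; rewrite /X' inE WG => /andP[].
    - case/fset0Pn: X0' => x xX; exists x; first exact: sXG.
      by apply/negP => /(fsubsetP sX'); rewrite inE xX.
  have /= eX' := eP _ PX'; have leX' := min1 _ PX'.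
  have c1 := fsubset_leq_card sX'.
  have c2 := cardfsDS sXW; have c3 : #|` X'| = _ := cardfsDS sXBW.
  have c4 := fsubset_leq_card sXW; have c5 := fsubset_leq_card sXBW.
  rewrite -/W in cUI; rewrite -cardfs_gt0 in IXY.
  have eqX' : e (finvset B, X') = e (B, X) by slia.
  have /= := min2 _ (conj PX' eqX').
  slia.
have [x0 x0X] := fset0Pn _ X0'.
pose H := flcoset x0^-1 X.
have transl g Y : g \in G -> P (B, Y) -> P (B, flcoset g Y) /\
    e (B, flcoset g Y) = e (B, Y).
  move=> gG' [_ /= [/fset0Pn[y yY] sYG [u uG uY]]]; split; last first.
    by rewrite /e /= fmul_flcoset !card_flcoset.
  split=> //; split.
  - by apply/fset0Pn; exists (g * y); rewrite /= mem_flcoset mulKg.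
  - by move=> x /=; rewrite mem_flcoset => /sYG; rewrite group_closedMl ?group_closedVE.
  - by exists (g * u); [exact: (group_closedM gG)|
      rewrite /= fmul_flcoset mem_flcoset mulKg].
have x0G := sXG _ x0X; have x0VG : x0^-1 \in G by rewrite group_closedVE.
have HX u : (u \in H) = (x0 * u \in X) by rewrite mem_flcoset invgK.
have H1 : 1 \in H by rewrite HX mulg1.
have HM a b : a \in H -> (a * b \in H) = (b \in H).
  move=> aH; have aX : x0 * a \in X by rewrite -HX.
  (* [g] sends the point [x0 * a] of [X] to [x0], so [gX] is an atom that meets [X] and hence equals
     it. *)
  rewrite !HX; pose g := x0 * a^-1 * x0^-1.
  have gG' : g \in G.
    have := sXG _ aX; rewrite (group_closedMl _ gG) // => aG.
    by rewrite /g !(group_closedM gG) ?group_closedVE.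
  have [Pg eg] := transl g X gG' PX.
  have gX : flcoset g X = X.
    apply: meet => //; first exact: card_flcoset.
    apply/fset0Pn; exists x0; rewrite inE x0X mem_flcoset /g.
    by rewrite !gnorm.
  by rewrite -[in RHS]gX mem_flcoset /g !gnorm.
have gH : group_closed [in H].
  by split=> // a b aH bH; change (a * b^-1 \in H); rewrite HM // -(HM b) // mulgV.
have [PH eH] := transl _ _ x0VG PX.
exists B, H; split=> //; first exact: (proj2 PH).
move=> Y sY; have PY : P (A, Y) by split; [left|].
have /= := eP _ PY; have /= := eP _ PH; have := min1 _ PY; rewrite eH -/H.
slia.
Qed.

End FiniteProducts.

(** * Counting cosets, subgroups of index two, normalisers *)

Section Cosets.
Local Open Scope fset_scope.
Local Open Scope group_scope.
Variable T : groupType.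
Implicit Types (A B X Y H K L : {fset T}) (S G : {pred T}) (x y z : T).

Lemma card_fsetU_disjoint X Y :
  {in X, forall x, x \notin Y} -> #|` X `|` Y| = (#|` X| + #|` Y|)%N.
Proof.
move=> dXY; rewrite -cardfsUI -[LHS]addn0; congr addn; apply/esym/eqP.
rewrite cardfs_eq0; apply/eqP/fsetP => x; rewrite !inE.
by apply/negP => /andP[/dXY/negP].
Qed.

Lemma frcoset_disjoint H x y : group_closed [in H] -> y / x \notin H ->
  {in frcoset H x, forall z, z \notin frcoset H y}.
Proof.
move=> gH yxH z; rewrite !mem_frcoset => zx; apply: contra yxH => zy.
by have := group_closedM gH (group_closedV gH zy) zx; rewrite !gnorm.
Qed.

Lemma subset_fmull X Y : 1 \in Y -> X `<=` fmul X Y.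
Proof.
by move=> Y1; apply/fsubsetP => x xX; rewrite -(mulg1 x) mem_fmul.
Qed.

Lemma frcoset_sub_fmul X Y x : x \in Y -> frcoset X x `<=` fmul X Y.
Proof.
move=> xY; apply/fsubsetP => z; rewrite mem_frcoset => zx.
by rewrite -(mulgVK x z) mem_fmul.
Qed.

Lemma frcoset1 X : frcoset X 1 = X.
Proof. by apply/fsetP => z; rewrite mem_frcoset !gnorm. Qed.

(** [HB] is a union of right cosets [Hb], among them [H] since [1] is in [B]; the cases are one,
    two, or at least three cosets. *)
Lemma coset_trichotomy H B : group_closed [in H] -> 1 \in B ->
  [\/ {subset B <= H},
      exists x, [/\ x \in B, x \notin H,
         {in B, forall b, b \in H \/ b / x \in H} &
         (2 * #|` H| <= #|` fmul H B|)%N]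
    | (3 * #|` H| <= #|` fmul H B|)%N].
Proof.
move=> gH B1.
have [|/existsNP[x /not_implyP[xB /negP xH]]] := pselect {subset B <= H}.
  by constructor 1.
have d1 : {in frcoset H 1, forall z, z \notin frcoset H x}.
  by apply: frcoset_disjoint => //; rewrite !gnorm.
have c1 := card_fsetU_disjoint d1.
have s1 : frcoset H 1 `|` frcoset H x `<=` fmul H B.
  by rewrite fsubUset !frcoset_sub_fmul.
have [BH|/existsNP[y /not_implyP[yB /not_orP[/negP yH /negP yx]]]] :=
  pselect {in B, forall b, b \in H \/ b / x \in H}.
  constructor 2; exists x; split=> //.
  have := fsubset_leq_card s1; rewrite c1 !card_frcoset; slia.
constructor 3.
have d2 : {in frcoset H 1 `|` frcoset H x, forall z, z \notin frcoset H y}.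
  move=> z /[!inE]/orP[]; apply: frcoset_disjoint => //.
  by rewrite !gnorm.
have s2 : frcoset H 1 `|` frcoset H x `|` frcoset H y `<=` fmul H B.
  by rewrite fsubUset s1 frcoset_sub_fmul.
have := fsubset_leq_card s2.
rewrite (card_fsetU_disjoint d2) c1 !card_frcoset; slia.
Qed.

(** The second clause puts all of [H] outside [L] into a single right coset of [L], the form that
    [coset_trichotomy] delivers. *)
Definition index2 L H := (exists2 u, u \in H & u \notin L) /\
  forall b c, b \in H -> c \in H -> b \notin L -> c \notin L -> c / b \in L.

Lemma index2_card L H : group_closed [in H] -> group_closed [in L] ->
  {subset L <= H} -> index2 L H -> (2 * #|` L|)%N = #|` H|.
Proof.
move=> gH gL sLH [[u uH uL] iL].
have -> : H = frcoset L 1 `|` frcoset L u.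
  apply/fsetP => b; rewrite inE frcoset1 mem_frcoset.
  apply/idP/orP => [bH|[/sLH//|/sLH]]; last by rewrite (group_closedMr _ gH) // group_closedVE.
  by case: (boolP (b \in L)) => bL; [left|right; apply: iL].
rewrite card_fsetU_disjoint; last by apply: frcoset_disjoint; rewrite ?gnorm.
rewrite !card_frcoset; slia.
Qed.

(** If [x] and [y ^ x] were both outside [L], their quotient [(y ^ x) / x = x^-1 * y] would lie in
    [L], and so would [x]. *)
Lemma index2_normal L H x y : group_closed [in H] -> group_closed [in L] ->
  {subset L <= H} -> index2 L H -> x \in H -> y \in L -> y ^ x \in L.
Proof.
move=> gH gL sLH [_ iL] xH yL.
case: (boolP (x \in L)) => xL.
  by rewrite conjgE !(group_closedM gL) // group_closedV.
apply/negPn/negP => yxL; case/negP: (xL).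
have := iL _ _ xH _ xL yxL.
rewrite conjgE !gnorm.
rewrite !(group_closedM gH) ?(group_closedV gH) ?(sLH _ yL) // => /(_ isT).
by rewrite (group_closedMr _ gL) // (group_closedVE _ gL) (negPf xL).
Qed.

Lemma subgroup_trichotomy L H : group_closed [in H] -> group_closed [in L] ->
    {subset L <= H} ->
  [\/ {subset H <= L}, index2 L H | (3 * #|` L| <= #|` H|)%N].
Proof.
move=> gH gL sLH; have sLHH : fmul L H `<=` H.
  apply/fsubsetP => _ /fmulP[a [b [/sLH aH bH ->]]]; exact: (group_closedM gH).
have [|[u [uH uL iu _]]|c] := coset_trichotomy gL (proj1 gH : 1 \in H).
- by constructor 1.
- constructor 2; split; first by exists u.
  move=> b c bH cH bL cL.
  case: (iu _ bH) => [bL'|bu]; first by rewrite bL' in bL.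
  case: (iu _ cH) => [cL'|cu]; first by rewrite cL' in cL.
  have := group_closedM gL cu (group_closedV gL bu); by rewrite !gnorm.
- constructor 3; exact: leq_trans c (fsubset_leq_card sLHH).
Qed.

(** Finiteness is essential: [x^-1 H x] is contained in [H] and has the same cardinality, so the two
    are equal. *)
Lemma conj_inv_closed H x : {in H, forall y, y ^ x \in H} ->
  {in H, forall y, y ^ x^-1 \in H}.
Proof.
move=> nH y yH; pose J := flcoset x^-1 (frcoset H x).
have JH : J = H.
  apply/eqP; rewrite eqEfcard card_flcoset card_frcoset leqnn andbT.
  apply/fsubsetP => z; rewrite mem_flcoset mem_frcoset invgK => /nH.
  by rewrite conjgE !gnorm.
by move: yH; rewrite -[in X in X -> _]JH mem_flcoset mem_frcoset conjgE invgK mulgA.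
Qed.

(** Stability under inverses comes from the finiteness of [H]. As a result, normality in [G] need
    only be checked on generators. *)
Lemma normaliser_closed H :
  group_closed [pred x | `[< {in H, forall y, y ^ x \in H} >]].
Proof.
split; first by apply/asboolP => y; rewrite conjg1.
move=> a b /asboolP na /asboolP nb; apply/asboolP => y yH.
by rewrite conjgM; apply: conj_inv_closed => //; apply: na.
Qed.

End Cosets.

(** * The target structure of [D] and criteria for it *)

Section Structure.
Local Open Scope fset_scope.
Local Open Scope group_scope.
Variable T : groupType.
Implicit Types (A B X Y H K L : {fset T}) (S : {pred T}) (x y z : T).

Lemma group_closed_fconj H x : group_closed [in H] ->
  group_closed [in flcoset x^-1 (frcoset H x)].
Proof.
move=> gH; have mJ z : (z \in flcoset x^-1 (frcoset H x)) = (x * z / x \in H).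
  by rewrite mem_flcoset mem_frcoset invgK.
split=> [|a b]; rewrite !mJ; first by rewrite !gnorm (proj1 gH).
by move=> aH bH; have := proj2 gH _ _ aH bH; rewrite !gnorm.
Qed.

Lemma group_closed_fsetI H K : group_closed [in H] -> group_closed [in K] ->
  group_closed [in H `&` K].
Proof.
move=> [H1 HF] [K1 KF]; split=> [|a b]; first by rewrite inE H1.
by rewrite !inE => /andP[aH aK] /andP[bH bK]; rewrite [_ \in H]HF ?[_ \in K]KF.
Qed.

Variables (G : {pred T}) (D : {fset T}).
Hypothesis genD : forall S, group_closed S -> {subset D <= S} -> {subset G <= S}.
Hypothesis properD : exists2 z, z \in G & z \notin D.

(** The conclusion for finite sets; [6|K| >= |D|] is omitted since it follows from the two
    cardinality clauses. *)
Definition three_layers := exists K H,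
  [/\ [/\ group_closed [in K], group_closed [in H], {subset K <= H} &
          {subset H <= D}],
      forall x y, x \in G -> y \in K -> y ^ x \in K,
      (#|` H| <= 2 * #|` K|)%N, #|` D| = (3 * #|` H|)%N &
      fmul D K = D /\ fmul K D = D].

(** The normaliser of [K] is a group containing [D], hence [G]. Then [k * d = d * k ^ d] reduces
    [KD = D] to [DK = D]. *)
Lemma three_layersI K H : group_closed [in K] -> group_closed [in H] ->
  {subset K <= H} -> {subset H <= D} ->
  (forall x y, x \in D -> y \in K -> y ^ x \in K) ->
  (forall x y, x \in D -> y \in K -> x * y \in D) ->
  (#|` H| <= 2 * #|` K|)%N -> #|` D| = (3 * #|` H|)%N -> three_layers.
Proof.
move=> gK gH sKH sHD nK mK cK cD; exists K, H; split=> //.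
  move=> x y xG yK.
  suff /asboolP : x \in [pred g | `[< {in K, forall y, y ^ g \in K} >]] by apply.
  apply: genD xG; first exact: normaliser_closed.
  by move=> z zD; apply/asboolP => w; apply: nK.
have K1 : 1 \in K := proj1 gK.
split; apply/fsetP => z; apply/idP/idP.
- by move=> /fmulP[x [y [xD yK ->]]]; apply: mK.
- by move=> zD; rewrite -(mulg1 z) mem_fmul.
- by move=> /fmulP[x [y [xK yD ->]]]; rewrite conjgC mK ?nK.
- by move=> zD; rewrite -(mul1g z) mem_fmul.
Qed.

(** * The case where [D] comes from two right cosets *)

Section TwoCosets.
Variables (H : {fset T}) (x : T).
Hypotheses (gH : group_closed [in H]) (xH : x \notin H).
Let J := flcoset x^-1 (frcoset H x).
Let L := H `&` J.

Lemma mem_fsetI_fconj z : (z \in L) = (z \in H) && (x * z / x \in H).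
Proof. by rewrite inE mem_flcoset mem_frcoset invgK. Qed.

Lemma group_closed_fsetI_fconj : group_closed [in L].
Proof. by apply: group_closed_fsetI => //; apply: group_closed_fconj. Qed.

Lemma sub_fsetI_fconj : {subset L <= H}.
Proof. by move=> z; rewrite mem_fsetI_fconj => /andP[]. Qed.

(** Conjugation by [y] swaps [H] and [H^x]: [y] in [Hx] gives [H^y = H^x], and [xy] in [H] gives
    [(H^x)^y = H]. *)
Lemma fsetI_fconj_norm y z : y / x \in H -> x * y \in H -> z \in L -> z ^ y \in L.
Proof.
move=> yx xy; rewrite !mem_fsetI_fconj conjgE => /andP[zH xzx]; apply/andP; split.
  have := group_closedM gH (group_closedM gH (group_closedV gH xy) xzx) xy.
  by rewrite !gnorm.
have := group_closedM gH (group_closedM gH (group_closedV gH yx) zH) yx.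
by rewrite !gnorm.
Qed.

(** The four sets [H], [Hx], [x^-1 H] and [H^x] collect the quotients [u^-1 * v] with [u], [v] in
    [H] or [Hx]. The constant 10 in [cD] will come from [3|D| < 5|A| <= 10|H|]. *)
Hypothesis mD : forall z, (z \in D) =
  [|| z \in H, z / x \in H, x * z \in H | x * z / x \in H].
Hypothesis cD : (3 * #|` D| < 10 * #|` H|)%N.

Let sHD : {subset H <= D}.
Proof. by move=> z zH; rewrite mD zH. Qed.

(** A common point of [H] or [H^x] with [Hx] or [x^-1 H] would put [x] in [H]. *)
Let card_layers : #|` D| = (#|` H `|` J| +
  #|` frcoset H x `|` flcoset x^-1 H|)%N.
Proof.
rewrite -card_fsetU_disjoint.
  congr (size (enum_fset _)); apply/fsetP => z.
  rewrite mD !inE !mem_flcoset !mem_frcoset invgK.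
  by case: (z \in H); case: (x * z / x \in H); case: (z / x \in H);
    case: (x * z \in H).
move=> z; rewrite !inE !mem_flcoset !mem_frcoset invgK negb_or.
case/orP => [zH|xzx]; apply/andP; split; apply: contra xH.
- by rewrite (group_closedMl _ gH) // (group_closedVE _ gH).
- by rewrite (group_closedMr _ gH).
- by move=> zx; rewrite -(group_closedMr _ gH zx) mulgA.
- by move=> xz; rewrite -(group_closedVE _ gH) -(group_closedMl _ gH xz).
Qed.

(** A nonempty intersection of [Hx] and [x^-1 H] is the left coset [yL] of any of its points [y]. *)
Let card_outer y : y / x \in H -> x * y \in H ->
  #|` frcoset H x `&` flcoset x^-1 H| = #|` L|.
Proof.
move=> yx xy; rewrite -(card_flcoset y L); congr (size (enum_fset _)).
apply/fsetP => z; rewrite mem_flcoset mem_fsetI_fconj inE mem_flcoset mem_frcoset invgK.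
rewrite andbC; congr andb.
  by rewrite -[in LHS](group_closedMl _ gH (group_closedV gH xy)) !gnorm.
by rewrite -[in LHS](group_closedMl _ gH (group_closedV gH yx)) !gnorm.
Qed.

(** By [card_layers], [|D|] is [4|H| - 2|L|] if [Hx] meets [x^-1 H] and [4|H| - |L|] otherwise, so
    [3|D| < 10|H|] rules out an index of [L] in [H] of 3 or more. *)
Lemma three_layers_two_cosets : three_layers.
Proof.
have gL := group_closed_fsetI_fconj; have sLH := sub_fsetI_fconj.
have cJ : #|` J| = #|` H| by rewrite card_flcoset card_frcoset.
have cHJ : (#|` H `|` J| + #|` L| = #|` H| + #|` H|)%N.
  by have := cardfsUI H J; rewrite cJ.
have cout := cardfsUI (frcoset H x) (flcoset x^-1 H).
rewrite card_flcoset card_frcoset in cout.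
have leL := fsubset_leq_card (fsubsetIl H J : L `<=` H).
have cHD := card_layers.
have [[y [yx xy]]|noy] := pselect (exists y, y / x \in H /\ x * y \in H).
  have cin := card_outer yx xy.
  have [sHL|iL|c3] := subgroup_trichotomy gH gL sLH; last by slia.
    have nHy : {in H, forall z, z ^ y \in H} by move=> z /sHL /(fsetI_fconj_norm yx xy)/sLH.
    have nHyV := conj_inv_closed nHy.
    have yyH : y * y \in H by have := group_closedM gH yx xy; rewrite !gnorm.
    (* Here [y] normalises [H] and [y * y] is in [H], so [H] and [Hy] form a group. It equals [D],
       which contradicts that [G] is not contained in [D]. *)
    pose S := [pred z | (z \in H) || (z / y \in H)].
    have gS : group_closed S.
      split=> [|a b]; first by rewrite inE (proj1 gH : 1 \in H).
      rewrite !inE => /orP[aH|ay] /orP[bH|by_]; apply/orP.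
      - by left; rewrite (group_closedMl _ gH) // (group_closedVE _ gH).
      - right; have := group_closedM gH (group_closedM gH aH
          (nHy _ (group_closedV gH by_))) (group_closedV gH yyH).
        by rewrite conjgE !gnorm.
      - right; have := group_closedM gH ay (nHyV _ (group_closedV gH bH)).
        by rewrite conjgE !gnorm.
      - left; have := group_closedM gH ay (group_closedV gH by_).
        by rewrite !gnorm.
    have DS z : (z \in D) = (z \in S).
      apply/idP/idP; rewrite mD inE; last first.
        case/orP=> [->//|zy]; have := group_closedM gH zy yx.
        by rewrite !gnorm => ->; rewrite orbT.
      case/or4P => [-> //|zx|xz|xzx]; apply/orP.
      - right; have := group_closedM gH zx (group_closedV gH yx).
        by rewrite !gnorm.
      - right; have := nHyV _ (group_closedM gH (group_closedV gH xy) xz).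
        by rewrite conjgE !gnorm.
      - left; have := group_closedM gH (group_closedM gH yx xzx) (group_closedV gH yx).
        by move=> /nHy; rewrite conjgE !gnorm.
    case: properD => z zG; case/negP; rewrite DS; apply: genD zG => // w.
    by rewrite DS.
  (* At index 2 take [K = L]: it is normalised by [H] and by [y], hence by [x], and
     [|D| = 4|H| - 2|L| = 3|H|]. *)
  have c2 := index2_card gH gL sLH iL.
  have nH g z : g \in H -> z \in L -> z ^ g \in L by exact: index2_normal.
  have nx : {in L, forall z, z ^ x \in L}.
    move=> z zL; have -> : x = (y / x)^-1 * y by rewrite !gnorm.
    by rewrite conjgM (fsetI_fconj_norm yx xy) // nH // (group_closedVE _ gH).
  have nxV := conj_inv_closed nx.
  apply: (three_layersI gL gH) => //; last 2 first.
  - slia.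
  - slia.
  - move=> g z; rewrite mD => /or4P[gHH|gx|xg|xgx] zL; first exact: nH.
    + by rewrite -(mulgVK x g) conjgM nx // nH.
    + by rewrite -(mulKg x g) conjgM nH // nxV.
    + rewrite -(mulKg x g) -(mulgVK x (x * g)) 2!conjgM nx // nH // nxV //.
  - move=> g z; rewrite mem_fsetI_fconj !mD => /or4P[gHH|gx|xg|xgx] /andP[zH xzx].
    + by rewrite (group_closedM gH).
    + have := group_closedM gH gx xzx.
      by rewrite !gnorm => ->; rewrite orbT.
    + by rewrite mulgA (group_closedM gH xg zH) !orbT.
    + have := group_closedM gH xgx xzx.
      by rewrite !gnorm => ->; rewrite !orbT.
(* With [Hx] and [x^-1 H] disjoint, only [L = H] survives; then [x] normalises [H] and [K = H]
   works. *)
have cin : #|` frcoset H x `&` flcoset x^-1 H| = 0%N.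
  apply/eqP; rewrite cardfs_eq0; apply/eqP/fsetP => y; rewrite !inE.
  rewrite mem_flcoset mem_frcoset invgK; apply/negP => /andP[yx xy].
  by apply: noy; exists y.
have [sHL|iL|c3] := subgroup_trichotomy gH gL sLH; last by slia.
  have nxV : {in H, forall z, z ^ x^-1 \in H}.
    by move=> z /sHL; rewrite mem_fsetI_fconj conjgE invgK mulgA => /andP[].
  have nx := conj_inv_closed nxV; rewrite invgK in nx.
  have nH g z : g \in H -> z \in H -> z ^ g \in H.
    by move=> gHH zH; rewrite conjgE !(group_closedM gH) // (group_closedVE _ gH).
  have cL : #|` H| = #|` L|.
    by apply/eqP; rewrite eqn_leq leL fsubset_leq_card //; apply/fsubsetP.
  apply: (three_layersI gH gH) => //; last 2 first.
  - slia.
  - slia.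
  - move=> g z; rewrite mD => /or4P[gHH|gx|xg|xgx] zL; first exact: nH.
    + by rewrite -(mulgVK x g) conjgM nx // nH.
    + by rewrite -(mulKg x g) conjgM nH // nxV.
    + by rewrite -(mulKg x g) -(mulgVK x (x * g)) 2!conjgM nx // nH // nxV.
  - move=> g z; rewrite !mD => /or4P[gHH|gx|xg|xgx] zH.
    + by rewrite (group_closedM gH).
    + have := group_closedM gH gx (nxV _ zH).
      by rewrite conjgE !gnorm => ->; rewrite orbT.
    + by rewrite mulgA (group_closedM gH xg zH) !orbT.
    + have := group_closedM gH xgx (nxV _ zH).
      by rewrite conjgE !gnorm => ->; rewrite !orbT.
(* Index 2 would give [2|D| = 7|H|], above the bound [10|H|/3] on [|D|]. *)
have c2 := index2_card gH gL sLH iL; slia.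
Qed.

End TwoCosets.

(** * The case where [D] comes from a double coset *)

Lemma mem_double_coset H x z :
  reflect (exists u v, [/\ u \in H, v \in H & z = u * x * v])
    (z \in fmul (frcoset H x) H).
Proof.
apply: (iffP (fmulP _ _ _)) => [[a [v [aH vH ->]]]|[u [v [uH vH ->]]]].
  by exists (a / x), v; rewrite -mem_frcoset mulgVK.
by exists (u * x), v; rewrite mem_frcoset mulgK.
Qed.

(** This lets [coset_trichotomy], applied to [H^x] and [H], measure [HxH]. *)
Lemma card_double_coset H x : #|` fmul (frcoset H x) H| =
  #|` fmul (flcoset x^-1 (frcoset H x)) H|.
Proof. by rewrite fmul_flcoset card_flcoset. Qed.

Lemma double_coset_disjoint H x z : group_closed [in H] -> x \notin H ->
  z \in H -> z \notin fmul (frcoset H x) H.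
Proof.
move=> gH xH zH; apply: contra xH => /mem_double_coset[u [v [uH vH zE]]].
by move: zH; rewrite zE (group_closedMr _ gH) // (group_closedMl _ gH).
Qed.

(** Here [HxH = Hx] and [H^x = H], so [D] has the two-coset form, its fourth set being [H] again. *)
Lemma three_layers_normal H x : group_closed [in H] -> x \notin H ->
    {in H, forall y, x * y / x \in H} ->
    (forall z, (z \in D) = [|| z \in H, z \in fmul (frcoset H x) H
                             | z^-1 \in fmul (frcoset H x) H]) ->
    (3 * #|` D| < 10 * #|` H|)%N ->
  three_layers.
Proof.
move=> gH xH nH mD; apply: (three_layers_two_cosets gH xH) => z.
have MH w : (w \in fmul (frcoset H x) H) = (w / x \in H).
  apply/mem_double_coset/idP => [[u [v [uH vH ->]]]|wx].
    by have := group_closedM gH uH (nH _ vH); rewrite !gnorm.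
  by exists (w / x), 1; rewrite (proj1 gH : 1 \in H) mulg1 mulgVK.
rewrite mD !MH -(group_closedVE (z^-1 / x) gH) invgM !invgK.
case zH : (z \in H) => //=; congr orb.
suff -> : (x * z / x \in H) = false by rewrite orbF.
apply/negP => xzx; move/negP: zH; apply.
have nH' : {in H, forall y, y ^ x^-1 \in H}.
  by move=> y /nH; rewrite conjgE invgK mulgA.
by have := conj_inv_closed nH' xzx; rewrite invgK conjgE !gnorm.
Qed.

(** Now [M = HxH] is closed under inverses and [|D| = |H| + |M|], so [|M|] is [|H|] or [2|H|]. The
    first is the normal case; in the second [L] has index 2 in [H] and is normalised by [x]. *)
Lemma three_layers_involution H x : group_closed [in H] -> x \notin H ->
    x * x \in H ->
    (forall z, (z \in D) = [|| z \in H, z \in fmul (frcoset H x) H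
                             | z^-1 \in fmul (frcoset H x) H]) ->
    (3 * #|` D| < 10 * #|` H|)%N ->
  three_layers.
Proof.
move=> gH xH xx mD cD; set M := fmul (frcoset H x) H in mD.
have MV z : (z^-1 \in M) = (z \in M).
  have sub w : w \in M -> w^-1 \in M.
    move=> /mem_double_coset[u [v [uH vH ->]]]; apply/mem_double_coset.
    exists v^-1, ((x * x)^-1 * u^-1); split; last by rewrite !gnorm.
      by rewrite (group_closedVE _ gH).
    by rewrite (group_closedM gH) ?(group_closedVE _ gH).
  by apply/idP/idP => /sub //; rewrite invgK.
have DE : D = H `|` M.
  by apply/fsetP => z; rewrite mD MV orbb inE.
have cDE : #|` D| = (#|` H| + #|` M|)%N.
  by rewrite DE card_fsetU_disjoint // => z; apply: double_coset_disjoint.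
set J := flcoset x^-1 (frcoset H x).
have gJ : group_closed [in J] by exact: group_closed_fconj.
have cJ : #|` J| = #|` H| by rewrite card_flcoset card_frcoset.
have mJ z : (z \in J) = (x * z / x \in H).
  by rewrite mem_flcoset mem_frcoset invgK.
have [HJ|[u [uH uJ iu c2]]|c3] := coset_trichotomy gJ (proj1 gH : 1 \in H).
- apply: (three_layers_normal gH xH _ mD cD) => y yH.
  by rewrite -mJ HJ.
- pose L := H `&` J.
  have gL : group_closed [in L] by exact: group_closed_fsetI_fconj.
  have sLH : {subset L <= H} by exact: sub_fsetI_fconj.
  have iL : index2 L H.
    split; first by exists u; rewrite // inE uH.
    move=> b c bH cH; rewrite !inE bH cH /= => bJ cJ'.
    rewrite (group_closedM gH cH) ?(group_closedVE _ gH) //=.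
    case: (iu _ bH) => [bJ'|bu]; first by rewrite bJ' in bJ.
    case: (iu _ cH) => [cJ''|cu]; first by rewrite cJ'' in cJ'.
    by have := group_closedM gJ cu (group_closedV gJ bu); rewrite !gnorm.
  have cL := index2_card gH gL sLH iL.
  have sM : M `<=` frcoset H x `|` frcoset H (x * u).
    apply/fsubsetP => _ /mem_double_coset[a [b [aH bH ->]]].
    rewrite inE !mem_frcoset; apply/orP.
    case: (iu _ bH); rewrite mJ => xbx; [left|right];
      by have := group_closedM gH aH xbx; rewrite !gnorm.
  have cM : (#|` M| <= #|` H| + #|` H|)%N.
    apply: leq_trans (fsubset_leq_card sM) _.
    by rewrite (leq_trans (leq_card_fsetU _ _)) // !card_frcoset.
  rewrite -card_double_coset -/M cJ in c2.
  have nH g z : g \in H -> z \in L -> z ^ g \in L by exact: index2_normal.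
  have nx : {in L, forall z, z ^ x \in L}.
    by move=> z; apply: fsetI_fconj_norm; rewrite // mulgV (proj1 gH : 1 \in H).
  apply: (three_layersI gL gH) => //.
  + by move=> z zH; rewrite DE inE zH.
  + move=> g z; rewrite DE inE => /orP[gHH|]; first exact: nH.
    by move=> /mem_double_coset[a [b [aH bH ->]]] zL; rewrite 2!conjgM nH // nx // nH.
  + move=> g z + /sLH zH; rewrite DE !in_fsetU => /orP[gHH|].
      by rewrite (group_closedM gH).
    move=> /mem_double_coset[a [b [aH bH ->]]]; apply/orP; right.
    by apply/mem_double_coset; exists a, (b * z); rewrite mulgA (group_closedM gH bH zH).
  + slia.
  + slia.
- rewrite -card_double_coset -/M cJ in c3; slia.
Qed.

(** If [M] and its inverse are disjoint, [|D| = |H| + 2|M|] forces [|M| = |H|], the normal case. If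
    they meet, [x] can be replaced by an element of [M] with square in [H]. *)
Lemma three_layers_double_coset H x : group_closed [in H] -> x \notin H ->
    (forall z, (z \in D) = [|| z \in H, z \in fmul (frcoset H x) H
                             | z^-1 \in fmul (frcoset H x) H]) ->
    (3 * #|` D| < 10 * #|` H|)%N ->
  three_layers.
Proof.
move=> gH xH mD cD; set M := fmul (frcoset H x) H in mD.
have [[z [zM zVM]]|noz] := pselect (exists z, z \in M /\ z^-1 \in M).
  have [u [v [uH vH zE]]] := elimT (mem_double_coset _ _ _) zM.
  have [u' [v' [uH' vH' zVE]]] := elimT (mem_double_coset _ _ _) zVM.
  (* From [z = u x v] and [z^-1 = u' x v'], the square of [x * w] is [u^-1 * v'^-1 * w], an element
     of [H]. *)
  pose w := v * u'; have wH : w \in H by exact: (group_closedM gH).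
  have MxM : fmul (frcoset H (x * w)) H = M.
    apply/fsetP => t; apply/mem_double_coset/mem_double_coset.
      move=> [a [b [aH bH ->]]]; exists a, (w * b).
      by rewrite (group_closedM gH wH bH) !mulgA.
    move=> [a [b [aH bH ->]]]; exists a, (w^-1 * b).
    by rewrite (group_closedM gH (group_closedV gH wH) bH) !gnorm.
  apply: (@three_layers_involution H (x * w)) => //.
  - by rewrite (group_closedMr _ gH).
  - have e : u * x * v * (u' * x * v') = 1 by rewrite -zE -zVE mulgV.
    have -> : x * w * (x * w) = u^-1 * (u * x * v * (u' * x * v')) * v'^-1 * w.
      by rewrite /w !gnorm.
    by rewrite e mulg1 !(group_closedM gH) ?(group_closedVE _ gH).
  - by rewrite MxM.
pose MV := finvset M.
have DE : D = H `|` M `|` MV by apply/fsetP => z; rewrite mD !inE mem_finvset orbA.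
have cD' : #|` D| = (#|` H| + #|` M| + #|` M|)%N.
  rewrite DE card_fsetU_disjoint; last first.
    move=> z; rewrite inE mem_finvset => /orP[zH|zM].
      by rewrite double_coset_disjoint // (group_closedVE _ gH).
    by apply/negP => zVM; apply: noz; exists z.
  by rewrite card_finvset card_fsetU_disjoint // => z; apply: double_coset_disjoint.
set J := flcoset x^-1 (frcoset H x).
have gJ : group_closed [in J] by exact: group_closed_fconj.
have cJ : #|` J| = #|` H| by rewrite card_flcoset card_frcoset.
have [HJ|[u [_ _ _ c2]]|c3] := coset_trichotomy gJ (proj1 gH : 1 \in H).
- apply: (three_layers_normal gH xH _ mD cD) => y /HJ.
  by rewrite mem_flcoset mem_frcoset invgK.
- rewrite -card_double_coset -/M cJ in c2; slia.
- rewrite -card_double_coset -/M cJ in c3; slia.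
Qed.

End Structure.

(** * Quotient sets: pigeonhole, fibre counting and the reduction to cosets *)

Section SmallQuotientSet.
Local Open Scope fset_scope.
Local Open Scope group_scope.
Variable T : groupType.
Implicit Types (A B X Y H K L : {fset T}) (S G : {pred T}) (x y z u v : T).

(** [Xu] and [Y] both lie in [H] and are too large to be disjoint. *)
Lemma quotient_full H X Y u : group_closed [in H] -> {subset X <= H} ->
    {subset Y <= H} -> (#|` H| < #|` X| + #|` Y|)%N -> u \in H ->
  exists x y, [/\ x \in X, y \in Y & x^-1 * y = u].
Proof.
move=> gH sXH sYH c uH; have : frcoset X u `&` Y != fset0.
  apply/eqP => I0; have := cardfsUI (frcoset X u) Y.
  rewrite I0 cardfs0 card_frcoset => cU.
  have := @fsubset_leq_card _ (frcoset X u `|` Y) H.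
  rewrite fsubUset; have -> /= : frcoset X u `<=` H.
    apply/fsubsetP => z; rewrite mem_frcoset => /sXH.
    by rewrite (group_closedMr _ gH) // (group_closedVE _ gH).
  have -> : Y `<=` H by apply/fsubsetP.
  move=> /(_ isT); slia.
case/fset0Pn => y /[!inE]/andP[]; rewrite mem_frcoset => yX yY.
by exists (y / u), y; rewrite !gnorm.
Qed.

Lemma cardfsM (K1 K2 : choiceType) (X : {fset K1}) (Y : {fset K2}) :
  #|` X `*` Y| = (#|` X| * #|` Y|)%N.
Proof.
rewrite /fsetM (perm_size (enum_imfset2 _ _)); first by rewrite size_allpairs.
by move=> [a b] [c d] _ _ /= [-> ->].
Qed.

(* The fibres of [(a, b) |-> a^-1 * x * b] on [H * H] have the size of
   [H `&` x^-1 H x]. *)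
Lemma card_double_coset_fibres H X Y x : group_closed [in H] ->
    {subset X <= H} -> {subset Y <= H} ->
  (#|` X| * #|` Y| <= #|` fmul (frcoset (finvset X) x) Y| *
     #|` H `&` flcoset x^-1 (frcoset H x)|)%N.
Proof.
move=> gH sXH sYH; set P := fmul _ _; set L := _ `&` _.
have repP p : exists b, p \in P -> b \in Y /\ x * b / p \in X.
  (* For [p = a^-1 * x * b] the recovered element [x * b / p] is [a]; the value [1] off [P] is a
     mere default. *)
  have [/fmulP[t [b [tX bY ->]]]|?] := boolP (p \in P); last by exists 1.
  exists b => _; split=> //; move: tX; rewrite mem_frcoset mem_finvset.
  by rewrite !gnorm.
have [rep repE] := choice repP.
have iP a b : a \in X -> b \in Y -> a^-1 * x * b \in P.
  by move=> aX bY; apply: mem_fmul; rewrite // mem_frcoset mulgK mem_finvset invgK.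
(* A pair is sent to its product and to its displacement from the chosen representative of the
   fibre. This is injective, and the displacement lies in [L]. *)
pose f (ab : T * T) := let p := ab.1^-1 * x * ab.2 in (p, rep p / ab.2).
rewrite -!cardfsM -(_ : #|` f @` (X `*` Y)| = #|` X `*` Y|); last first.
  rewrite card_in_imfset // => -[a b] [c d] _ _ [] /[swap] + e.
  rewrite e => /mulgI /invg_inj bd; move: e; rewrite bd => /mulIg /mulIg /invg_inj ->.
  by [].
apply/fsubset_leq_card/fsubsetP => _ /imfsetP[[a b] /= abXY ->].
move: abXY; rewrite !inE /= => /andP[aX bY].
have pP := iP _ _ aX bY; have [rY rX] := repE _ pP.
rewrite pP (group_closedM gH) ?(group_closedVE _ gH) ?sYH //=.
rewrite mem_flcoset mem_frcoset invgK.
have := group_closedM gH (sXH _ rX) (group_closedV gH (sXH _ aX)).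
by rewrite !gnorm.
Qed.

Section Generated.
Variables (G : {pred T}) (A : {fset T}).
Let D := fmul (finvset A) A.
Hypothesis gG : group_closed G.
Hypothesis genD : forall S, group_closed S -> {subset D <= S} -> {subset G <= S}.
Hypothesis sDG : {subset D <= G}.
Hypothesis properD : exists2 z, z \in G & z \notin D.
Hypothesis smallD : (3 * #|` D| < 5 * #|` A|)%N.

Let memD a b : a \in A -> b \in A -> a^-1 * b \in D.
Proof. by move=> aA bA; apply: mem_fmul; rewrite // mem_finvset invgK. Qed.

Let memDP z : z \in D -> exists a b, [/\ a \in A, b \in A & z = a^-1 * b].
Proof.
by move=> /fmulP[a [b [aA bA ->]]]; exists a^-1, b; rewrite invgK -mem_finvset.
Qed.

(** Each of [A1], [A2] has at most [|H|] elements and together they have more than [3|H|/2], so each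
    exceeds [|H|/2]. Hence [quotient_full] applies to all four pairs. *)
Lemma three_layers_right_cosets H x : group_closed [in H] -> x \notin H ->
    {in A, forall a, a \in H \/ a / x \in H} -> (3 * #|` H| < 2 * #|` A|)%N ->
  three_layers G D.
Proof.
move=> gH xH sA cH; pose A1 := A `&` H; pose A2 := frcoset (A `\` H) x^-1.
have s1 : {subset A1 <= H} by move=> a /[!inE]/andP[].
have s2 : {subset A2 <= H}.
  move=> a; rewrite mem_frcoset invgK inE => /andP[aH aA].
  by case: (sA _ aA); rewrite ?mulgK // => aH'; rewrite aH' in aH.
have c1 := fsubset_leq_card (introT (@fsubsetP _ _ _) s1).
have c2 := fsubset_leq_card (introT (@fsubsetP _ _ _) s2).
have cA : (#|` A1| + #|` A2|)%N = #|` A| by rewrite card_frcoset cardfsID.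
have m1 a : a \in A1 -> a \in A by rewrite inE => /andP[].
have m2 a : a \in A2 -> a * x \in A by rewrite mem_frcoset invgK inE => /andP[].
apply: (three_layers_two_cosets genD properD gH xH) => [z|]; last by slia.
apply/idP/or4P => [/memDP[a [b [aA bA ->]]]|].
  case: (sA _ aA) => aH; case: (sA _ bA) => bH.
  - by constructor 1; rewrite (group_closedM gH) // (group_closedVE _ gH).
  - by constructor 2; rewrite -mulgA (group_closedM gH) // (group_closedVE _ gH).
  - constructor 3; have := group_closedM gH (group_closedV gH aH) bH.
    by rewrite !gnorm.
  - constructor 4; have := group_closedM gH (group_closedV gH aH) bH.
    by rewrite !gnorm.
case=> [zH|zx|xz|xzx].
- have [|a [b [/m1 aA /m1 bA <-]]] := quotient_full gH s1 s1 _ zH; first by slia.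
  exact: memD.
- have [|a [b [/m1 aA /m2 bA e]]] := quotient_full gH s1 s2 _ zx; first by slia.
  by rewrite -(mulgVK x z) -e -mulgA memD.
- have [|a [b [/m2 aA /m1 bA e]]] := quotient_full gH s2 s1 _ xz; first by slia.
  by have := memD aA bA; rewrite invgM -mulgA e mulKg.
- have [|a [b [/m2 aA /m2 bA e]]] := quotient_full gH s2 s2 _ xzx; first by slia.
  by have := memD aA bA; rewrite invgM -mulgA (mulgA a^-1) e !gnorm.
Qed.

Lemma three_layers_left_cosets H x : group_closed [in H] -> x \notin H ->
    {in A, forall a, a \in H \/ x^-1 * a \in H} -> (3 * #|` H| < 2 * #|` A|)%N ->
  three_layers G D.
Proof.
move=> gH xH sA cH; pose A1 := A `&` H; pose A2 := flcoset x^-1 (A `\` H).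
have s1 : {subset A1 <= H} by move=> a /[!inE]/andP[].
have s2 : {subset A2 <= H}.
  move=> a; rewrite mem_flcoset invgK inE => /andP[aH aA].
  by case: (sA _ aA); rewrite ?mulKg // => aH'; rewrite aH' in aH.
have c1 := fsubset_leq_card (introT (@fsubsetP _ _ _) s1).
have c2 := fsubset_leq_card (introT (@fsubsetP _ _ _) s2).
have cA : (#|` A1| + #|` A2|)%N = #|` A| by rewrite card_flcoset cardfsID.
have m1 a : a \in A1 -> a \in A by rewrite inE => /andP[].
have m2 a : a \in A2 -> x * a \in A by rewrite mem_flcoset invgK inE => /andP[].
pose P := fmul (frcoset (finvset A1) x) A2.
have sPM : P `<=` fmul (frcoset H x) H.
  apply/fsubsetP => _ /fmulP[a [b [aA /s2 bH ->]]]; apply: mem_fmul => //.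
  by move: aA; rewrite !mem_frcoset mem_finvset => /s1; rewrite (group_closedVE _ gH).
have sPD : P `<=` D.
  apply/fsubsetP => _ /fmulP[a [b [aA /m2 bA ->]]].
  move: aA; rewrite mem_frcoset mem_finvset => /m1 aA.
  by have := memD aA bA; rewrite !gnorm.
have sHD z : z \in H -> z \in D.
  move=> zH; have [|a [b [/m1 aA /m1 bA <-]]] := quotient_full gH s1 s1 _ zH.
    slia.
  exact: memD.
pose L := H `&` flcoset x^-1 (frcoset H x).
have mL z : (z \in L) = (z \in H) && (x * z / x \in H) by exact: mem_fsetI_fconj.
have gL : group_closed [in L] by exact: group_closed_fsetI_fconj.
have sLH : {subset L <= H} by exact: sub_fsetI_fconj.
have DV z : z^-1 \in D -> z \in D.
  move=> /memDP[a [b [aA bA zE]]].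
  by rewrite -(invgK z) zE invgM invgK memD.
have [|c3] := leqP #|` H| (2 * #|` L|)%N; last first.
  have [sHL|iL|{}c3] := subgroup_trichotomy gH gL sLH.
  - have := fsubset_leq_card (introT (@fsubsetP _ _ _) sHL); slia.
  - have := index2_card gH gL sLH iL; slia.
  have cPH : (#|` H| + #|` P| <= #|` D|)%N.
    rewrite -card_fsetU_disjoint; last first.
      move=> z /(double_coset_disjoint gH xH); apply: contra.
      exact: (fsubsetP sPM).
    by rewrite fsubset_leq_card // fsubUset sPD andbT; apply/fsubsetP.
  (* With [3|L| <= |H|], the fibre count and [(|H| - |A1|)(|H| - |A2|) >= 0] give
     [|P| >= 3(|A| - |H|)]. Then [|D| >= 3|A| - 2|H|], against [3|D| < 5|A|] and [3|H| < 2|A|]. *)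
  have := card_double_coset_fibres x gH s1 s2; rewrite -/P -/L.
  move: c1 c2 cA c3 cPH cH smallD; rewrite /=.
  move: #|` A1| #|` A2| #|` A| #|` P| #|` L| #|` H| #|` D| => a1 a2 n p l h d.
  nia.
move=> c2L.
have sMP z : z \in fmul (frcoset H x) H -> z \in D.
  move=> /mem_double_coset[u [v [uH vH ->]]].
  (* Each [m] in [L] writes [u x v] as [a^-1 * x * b] with [a = x m x^-1 u^-1] and [b = m v]. [X1]
     and [X2] hold the [m] with [a] outside [A1] or [b] outside [A2]; their sizes add up to
     [2|H| - |A| < |H|/2 <= |L|], so some [m] avoids both. *)
  pose X1 := flcoset x^-1 (frcoset (frcoset (H `\` A1) u) x).
  pose X2 := frcoset (H `\` A2) v^-1.
  have : ~~ (L `<=` X1 `|` X2).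
    apply/negP => /fsubset_leq_card; have := leq_of_leqif (leq_card_fsetU X1 X2).
    rewrite card_flcoset !card_frcoset !cardfsDS; try exact/fsubsetP.
    slia.
  move=> /fsubsetPn[m]; rewrite mL => /andP[mH xmx].
  rewrite in_fsetU negb_or mem_flcoset !mem_frcoset !invgK !in_fsetD.
  rewrite (group_closedM gH mH vH) (group_closedM gH xmx (group_closedV gH uH)).
  rewrite !andbT !negbK => /andP[/m1 aA /m2 bA].
  by have := memD aA bA; rewrite !gnorm.
apply: (three_layers_double_coset genD properD gH xH) => [z|]; last by slia.
apply/idP/or3P => [/memDP[a [b [aA bA ->]]]|[/sHD//|/sMP//|/sMP/DV//]].
case: (sA _ aA) => aH; case: (sA _ bA) => bH.
- by constructor 1; rewrite (group_closedM gH) // (group_closedVE _ gH).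
- constructor 2; apply/mem_double_coset; exists a^-1, (x^-1 * b).
  by rewrite (group_closedVE _ gH) !gnorm.
- constructor 3; apply/mem_double_coset; exists b^-1, (x^-1 * a).
  by rewrite (group_closedVE _ gH) !gnorm.
- constructor 1; have := group_closedM gH (group_closedV gH aH) bH.
  by rewrite !gnorm.
Qed.

(** The set [A^-1] is itself separated for [A], as [D] misses a point of [G]; comparing the atom
    with it gives [|HB| - |H| <= |D| - |A|]. *)
Lemma three_layers_small_quotient : 1 \in A -> three_layers G D.
Proof.
move=> A1.
have sAD a : a \in A -> a \in D by move=> aA; rewrite -(mul1g a) -invg1 memD.
have sVG : {subset finvset A <= G}.
  by move=> a; rewrite mem_finvset => /sAD/sDG; rewrite (group_closedVE _ gG).
have sVA : separated G A (finvset A).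
  by split=> //; apply/fset0Pn; exists 1; rewrite mem_finvset invg1.
have [||B [H [BA gH [_ sHG [z zG zH]] minH]]] :=
  atom_subgroup gG _ _ (ex_intro _ _ sVA).
- by move=> a /sAD/sDG.
- by apply/fset0Pn; exists 1.
have {minH} := minH _ sVA; rewrite card_finvset -/D => cHB.
have B1 : 1 \in B by case: BA => ->; rewrite // mem_finvset invg1.
have cB : #|` B| = #|` A| by case: BA => ->; rewrite // card_finvset.
have [BH|[x [xB xH sB c2]]|c3] := coset_trichotomy gH B1.
- have AH : {subset A <= H}.
    move=> a aA; case: BA BH => -> BH; first exact: BH.
    by rewrite -(group_closedVE _ gH) BH // mem_finvset invgK.
  have sDH : {subset D <= [in H]}.
    move=> _ /memDP[a [b [/AH aH /AH bH ->]]].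
    exact: (group_closedM gH (group_closedV gH aH) bH).
  case/negP: zH; apply: (fsubsetP (subset_fmull H B1)).
  exact: (genD gH sDH).
- have cH : (3 * #|` H| < 2 * #|` A|)%N by slia.
  case: BA => BA; rewrite BA in sB.
    exact: (three_layers_right_cosets gH xH sB cH).
  (* Inversion turns the right coset [Hx] that meets [A^-1] into the left coset [x^-1 H] that meets
     [A]. *)
  have xVH : x^-1 \notin H by rewrite (group_closedVE _ gH).
  apply: (three_layers_left_cosets gH xVH _ cH) => a aA.
  have [|aH|aH] := sB a^-1; first by rewrite mem_finvset invgK.
    by left; rewrite -(group_closedVE _ gH).
  by right; rewrite -(group_closedVE _ gH) !gnorm.
(* Three cosets would give [|HB| - |H| >= 2|HB|/3 >= 2|A|/3], too much. *)
- have cBH : (#|` B| <= #|` fmul H B|)%N.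
    rewrite -(card_flcoset 1 B); apply/fsubset_leq_card/fsubsetP => b.
    rewrite mem_flcoset invg1 mul1g => bB; rewrite -(mul1g b) mem_fmul //.
    exact: (proj1 gH).
  slia.
Qed.

End Generated.
End SmallQuotientSet.

Import Order.TTheory GRing.Theory Num.Theory.

(** * Passage from classical sets to finite sets *)

Section SetsOfGroups.
Local Open Scope classical_set_scope.
Local Open Scope group_scope.
Variable T : groupType.
Implicit Types (X Y : {fset T}) (S : set T).

Lemma ecard_fset X : ecard [set` X] = ((#|` X|)%fset%:R)%R%:E.
Proof. by rewrite /ecard set_fsetK; case: asboolP => // -[]; exact: finite_fset. Qed.

(** If [S] lay inside [X] it would be finite, and its cardinality could not exceed that of [X]; an
    infinite [S] is thus covered. *)
Lemma ecard_proper S X : (ecard [set` X] < ecard S)%E ->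
  exists2 z, S z & z \notin X.
Proof.
move=> ltXS; apply: contrapT => noz; move: ltXS; apply/negP; rewrite -leNgt.
have sSX : S `<=` [set` X].
  by move=> z Sz; apply/negPn/negP => zX; apply: noz; exists z.
have finS : finite_set S by apply: sub_finite_set sSX _; exact: finite_fset.
rewrite -(fset_setK finS) !ecard_fset lee_fin ler_nat.
apply/fsubset_leq_card/fsubsetP => z; rewrite in_fset_set // inE.
exact: sSX.
Qed.

Lemma mulset_fset X Y : mulset [set` X] [set` Y] = [set` fmul X Y].
Proof.
apply/seteqP; split=> z /=.
  by move=> [x xX [y yY <-]]; apply: mem_fmul.
by move=> /fmulP[x [y [xX yY ->]]]; exists x => //; exists y.
Qed.

Lemma invset_fset X : invset [set` X] = [set` finvset X].
Proof.
apply/seteqP; split=> z /=; rewrite mem_finvset; first by move=> [x xX <-]; rewrite invgK.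
by move=> zX; exists z^-1; rewrite ?invgK.
Qed.

Lemma group_closed_eq (S1 S2 : {pred T}) :
  S1 =i S2 -> group_closed S1 -> group_closed S2.
Proof.
by move=> eqS [S1_1 S1F]; split=> [|a b]; rewrite -!eqS //; apply: S1F.
Qed.

Lemma is_subgroup_fset X : group_closed [in X] -> is_subgroup [set` X].
Proof. by apply: group_closed_eq => x; apply/idP/idP => [/mem_set|/set_mem]. Qed.

Lemma generated_subgroup S : is_subgroup (generated S).
Proof.
split=> [|a b /set_mem Sa /set_mem Sb].
  by apply/mem_set => H [[/set_mem H1 _] _].
apply/mem_set => H CH; apply/set_mem/(proj2 (proj1 CH)).
  exact/mem_set/(Sa H CH).
exact/mem_set/(Sb H CH).
Qed.

Lemma generated_min S (P : {pred T}) : group_closed P ->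
  (forall x, S x -> x \in P) -> forall x, generated S x -> x \in P.
Proof.
move=> gP SP x /(_ [set y | y \in P]); apply; split; last exact: SP.
by apply: group_closed_eq gP => y; apply/idP/idP => [/mem_set|/set_mem].
Qed.

(** The factors [a^-1] and [a] cancel; this permits translating [A] so that it contains [1]. *)
Lemma fmul_finvset_flcoset (a : T) X :
  fmul (finvset (flcoset a X)) (flcoset a X) = fmul (finvset X) X.
Proof.
apply/fsetP => z; apply/fmulP/fmulP => -[x [y []]].
  rewrite mem_finvset !mem_flcoset => xX yX ->.
  by exists (x * a), (a^-1 * y); rewrite mem_finvset !gnorm.
rewrite mem_finvset => xX yX ->; exists (x * a^-1), (a * y).
by rewrite mem_finvset !mem_flcoset !gnorm.
Qed.

End SetsOfGroups.
Local Open Scope classical_set_scope.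
Local Open Scope ring_scope.
Local Open Scope ereal_scope.

Theorem theorem5p1 (G0 : groupType) (A : set G0) (finA : finite_set A) :
  let D := mulset (invset A) A in
  let G := generated D in
  ecard D < Order.min (ecard G) (5%:E * ecard A * (3^-1)%:E) ->
  exists K H : set G0,
    [/\ normal_subgroup_of K G,
        subgroup_of H G,
        K `<=` H /\ H `<=` D,
        2%:E * ecard K >= ecard H
      & [/\ mulset D K = mulset K D,
            mulset K D = D,
            6%:E * ecard K >= ecard D
          & ecard D = 3%:E * ecard H]].
Proof.
move: finA => /fset_setK; move: (fset_set A) => X <-{A} D G.
pose DX := fmul (finvset X) X.
have DE : D = [set` DX] by rewrite /D invset_fset mulset_fset.
rewrite lt_min => /andP[ltG ltA].
have properG : exists2 z, z \in [in G] & z \notin DX.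
  rewrite DE in ltG; have [z Gz zD] := ecard_proper ltG.
  by exists z => //; apply/mem_set.
have smallD : (3 * #|` DX|%fset < 5 * #|` X|%fset)%N.
  move: ltA; rewrite DE !ecard_fset -!EFinM lte_fin.
  rewrite ltr_pdivlMr // -!natrM ltr_nat; lia.
(* The strict bound [3|D| < 5|A|] already excludes an empty [A]. *)
have /fset0Pn[a aX] : X != fset0.
  by rewrite -cardfs_gt0; lia.
pose Y := flcoset a^-1%g X.
have YD : fmul (finvset Y) Y = DX by exact: fmul_finvset_flcoset.
have sDG x : x \in DX -> x \in [in G].
  by move=> xD; apply/mem_set => H [_]; apply; rewrite DE.
have genD (S : {pred G0}) : group_closed S -> {subset DX <= S} ->
    {subset [in G] <= S}.
  move=> gS sS x /set_mem; apply: generated_min => // y; rewrite DE; exact: sS.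
have : three_layers [in G] (fmul (finvset Y) Y).
  apply: three_layers_small_quotient; rewrite ?YD //.
  - exact: generated_subgroup.
  - by rewrite card_flcoset.
  - by rewrite mem_flcoset invgK mulg1.
rewrite YD => -[K [H [[gK gH sKH sHD] nK cK cD [DK KD]]]].
have sDG' x : x \in DX -> G x by move=> /sDG/set_mem.
exists [set` K], [set` H]; rewrite DE !mulset_fset DK KD !ecard_fset.
rewrite -!EFinM !lee_fin -!natrM !ler_nat cD; split=> //.
- split; first by split; [exact: is_subgroup_fset|move=> x /sKH/sHD/sDG'].
  by move=> x y Gx; apply: nK; apply/mem_set.
- by split; [exact: is_subgroup_fset|move=> x /sHD/sDG'].
- by split=> //; lia.
Qed.
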